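(* Let $A$ be a Dedekind domain with $\mathbb{Z}[T]\subset A\subset\mathbb{Q}[T]$ such that for each maximal ideal $\mathfrak{M}\subset A$ the field $A/\mathfrak{M}$ is finite, such that the group $A^\times$ is finitely generated, and such that the class group of $A$, i.e. $\operatorname{Pic}(A)$, is not a torsion group. Then $A$ is a good ring. Moreover, for every primitive point $(a,b)\in A^2$, the Picard group of the ring $\mathcal{O}_{S(a,b)}(S(a,b))$ is not a torsion group, and $A$ is not a pictorsion ring.
   Context: All rings are commutative and unital; $A^\times$ denotes the unit group of $A$. $\mathbb{Z}[T]$ and $\mathbb{Q}[T]$ are polynomial rings in one variable. The existence of a ring $A$ as in the statement is a result of Goldman. A point $(a,b)\in A^2$ is primitive if $aA+bA=A$; a primitive point $(a,b)$ is a good point if there are an integer $N\ge 1$ and $\lambda\in A$ with $b^N+\lambda a\in A^\times$. The ring $A$ is a good ring if every primitive point in $A^2$ is a good point. For a primitive point $(a,b)\in A^2$, $S(a,b):=\operatorname{Proj}\bigl(A[X,Y]/X(aY-bX)A[X,Y]\bigr)$, with the grading induced by the standard grading of $A[X,Y]$. A ring $A$ is a pictorsion ring if for every ring $B$ which is finite over $A$ (i.e. an $A$-algebra that is finitely generated as an $A$-module), $\operatorname{Pic}(B)$ is a torsion group. *)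

(* Defs.v *)
From HB Require Import structures.
From mathcomp Require Import all_boot all_order all_algebra ring.
From mathcomp Require Import mpoly.
From mathcomp Require Import boolp classical_sets cardinality.

Set Implicit Arguments.
Unset Strict Implicit.
Unset Printing Implicit Defensive.

Import GRing.Theory.
Local Open Scope ring_scope.
Local Open Scope quotient_scope.

Section TensorProduct.
Variables (R : comPzRingType) (M N : lmodType R).

(* A sequence of pairs stands for a finite sum of pure tensors. *)
Inductive tensor_eq : seq (M * N) -> seq (M * N) -> Prop :=
| tensor_eq_refl s : tensor_eq s s
| tensor_eq_sym s t : tensor_eq s t -> tensor_eq t s
| tensor_eq_trans t s u : tensor_eq s t -> tensor_eq t u -> tensor_eq s u
| tensor_eq_cat s s' t t' :
    tensor_eq s s' -> tensor_eq t t' -> tensor_eq (s ++ t) (s' ++ t')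
| tensor_eq_catC s t : tensor_eq (s ++ t) (t ++ s)
| tensor_eq_0l y : tensor_eq [:: (0, y)] [::]
| tensor_eq_Dl x x' y : tensor_eq [:: (x + x', y)] [:: (x, y); (x', y)]
| tensor_eq_Dr x y y' : tensor_eq [:: (x, y + y')] [:: (x, y); (x, y')]
| tensor_eq_Z (a : R) x y : tensor_eq [:: (a *: x, y)] [:: (x, a *: y)].

Definition tensor_rel (s t : seq (M * N)) : bool := `[< tensor_eq s t >].

Lemma tensor_rel_equiv : equiv_class_of tensor_rel.
Proof.
split=> [s|s t|t s u]; first by apply/asboolP; exact: tensor_eq_refl.
  by apply/asboolP/asboolP; exact: tensor_eq_sym.
by move=> /asboolP st /asboolP tu; apply/asboolP; exact: tensor_eq_trans st tu.
Qed.

Canonical tensor_rel_equivRel := EquivRelPack tensor_rel_equiv.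
Canonical tensor_rel_encModRel := defaultEncModRel tensor_rel.

Definition tensor := {eq_quot tensor_rel}.
HB.instance Definition _ : EqQuotient _ tensor_rel tensor :=
  EqQuotient.on tensor.
HB.instance Definition _ := Choice.on tensor.

Lemma tensor_piE (s t : seq (M * N)) :
  tensor_eq s t -> \pi_tensor s = \pi_tensor t.
Proof. by move=> st; apply/(@eqquotP _ _ tensor)/asboolP. Qed.

Lemma tensor_reprE (s : seq (M * N)) : tensor_eq (repr (\pi_tensor s)) s.
Proof. by apply/asboolP/(@eqquotP _ _ tensor); rewrite reprK. Qed.

Lemma tensor_surj (u : tensor) : exists s, u = \pi_tensor s.
Proof. by exists (repr u); rewrite reprK. Qed.

Definition tensor_scale_seq (a : R) (s : seq (M * N)) : seq (M * N) :=
  [seq (a *: u.1, u.2) | u <- s].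

Lemma tensor_scale_seq_eq a s t :
  tensor_eq s t -> tensor_eq (tensor_scale_seq a s) (tensor_scale_seq a t).
Proof.
elim=> {s t} [s|s t _ st|t s u _ st _ tu|s s' t t' _ ss' _ tt'|s t|y|x x' y|
             x y y'|b x y] /=.
- exact: tensor_eq_refl.
- exact: tensor_eq_sym.
- exact: tensor_eq_trans st tu.
- by rewrite /tensor_scale_seq !map_cat; exact: tensor_eq_cat.
- by rewrite /tensor_scale_seq !map_cat; exact: tensor_eq_catC.
- by rewrite scaler0; exact: tensor_eq_0l.
- by rewrite scalerDr; exact: tensor_eq_Dl.
- exact: tensor_eq_Dr.
- by rewrite scalerA mulrC -scalerA; exact: tensor_eq_Z.
Qed.

Definition tensor_zero : tensor := \pi_tensor [::].
Definition tensor_add (u v : tensor) : tensor := \pi_tensor (repr u ++ repr v).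
Definition tensor_scale (a : R) (u : tensor) : tensor :=
  \pi_tensor (tensor_scale_seq a (repr u)).
Definition tensor_opp (u : tensor) : tensor := tensor_scale (-1) u.

Lemma tensor_addE (s t : seq (M * N)) :
  tensor_add (\pi_tensor s) (\pi_tensor t) = \pi_tensor (s ++ t).
Proof. by apply: tensor_piE; apply: tensor_eq_cat; exact: tensor_reprE. Qed.

Lemma tensor_scaleE a (s : seq (M * N)) :
  tensor_scale a (\pi_tensor s) = \pi_tensor (tensor_scale_seq a s).
Proof.
by apply: tensor_piE; apply: tensor_scale_seq_eq; exact: tensor_reprE.
Qed.

Lemma tensor_addA : associative tensor_add.
Proof.
move=> u v w; have [[r ->] [s ->] [t ->]] :=
  And3 (tensor_surj u) (tensor_surj v) (tensor_surj w).
by rewrite !tensor_addE catA.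
Qed.

Lemma tensor_addC : commutative tensor_add.
Proof.
move=> u v; have [[s ->] [t ->]] := conj (tensor_surj u) (tensor_surj v).
rewrite !tensor_addE.
by apply: tensor_piE; exact: tensor_eq_catC.
Qed.

Lemma tensor_add0 : left_id tensor_zero tensor_add.
Proof. by move=> u; have [s ->] := tensor_surj u; rewrite tensor_addE. Qed.

Lemma tensor_scaleDl (u : tensor) (a b : R) :
  tensor_scale (a + b) u = tensor_add (tensor_scale a u) (tensor_scale b u).
Proof.
have [s ->] := tensor_surj u; rewrite !tensor_scaleE tensor_addE.
apply: tensor_piE.
elim: s => [|[x y] s IH]; rewrite ?map_cons /=; first exact: tensor_eq_refl.
rewrite scalerDl -cat1s.
apply: (@tensor_eq_trans ([:: (a *: x, y); (b *: x, y)] ++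
  (tensor_scale_seq a s ++ tensor_scale_seq b s))).
  by apply: tensor_eq_cat => //; exact: tensor_eq_Dl.
rewrite /= -cat1s -[X in tensor_eq _ X]cat1s.
apply: tensor_eq_cat; first exact: tensor_eq_refl.
rewrite -cat1s -[X in tensor_eq _ (_ ++ X)]cat1s !catA.
apply: tensor_eq_cat; last exact: tensor_eq_refl.
exact: tensor_eq_catC.
Qed.

Lemma tensor_scale0 (u : tensor) : tensor_scale 0 u = tensor_zero.
Proof.
have [s ->] := tensor_surj u; rewrite tensor_scaleE; apply: tensor_piE.
elim: s => [|[x y] s IH]; rewrite ?map_cons /=; first exact: tensor_eq_refl.
rewrite scale0r -cat1s -[[::] in X in tensor_eq _ X]cats0.
by apply: tensor_eq_cat => //; exact: tensor_eq_0l.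
Qed.

Lemma tensor_scale1 : left_id 1 tensor_scale.
Proof.
move=> u; have [s ->] := tensor_surj u.
rewrite tensor_scaleE /tensor_scale_seq; congr (\pi_tensor _).
by rewrite -[RHS]map_id; apply: eq_map => -[x y] /=; rewrite scale1r.
Qed.

Lemma tensor_addN : left_inverse tensor_zero tensor_opp tensor_add.
Proof.
move=> u; rewrite -{2}[u]tensor_scale1 /tensor_opp -tensor_scaleDl addNr.
exact: tensor_scale0.
Qed.

HB.instance Definition _ :=
  GRing.isZmodule.Build tensor tensor_addA tensor_addC tensor_add0 tensor_addN.

Lemma tensor_scaleA (a b : R) (u : tensor) :
  tensor_scale a (tensor_scale b u) = tensor_scale (a * b) u.
Proof.
have [s ->] := tensor_surj u; rewrite !tensor_scaleE.
rewrite /tensor_scale_seq -map_comp; congr (\pi_tensor _).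
by apply: eq_map => -[x y] /=; rewrite scalerA.
Qed.

Lemma tensor_scaleDr : right_distributive tensor_scale tensor_add.
Proof.
move=> a u v; have [[s ->] [t ->]] := conj (tensor_surj u) (tensor_surj v).
by rewrite tensor_addE !tensor_scaleE tensor_addE /tensor_scale_seq map_cat.
Qed.

HB.instance Definition _ := GRing.Zmodule_isLmodule.Build R tensor
  tensor_scaleA tensor_scale1 tensor_scaleDr tensor_scaleDl.

Definition pure_tensor (x : M) (y : N) : tensor := \pi_tensor [:: (x, y)].

Lemma tensor_pi_cat s t : \pi_tensor (s ++ t) = \pi_tensor s + \pi_tensor t.
Proof. by rewrite [RHS]tensor_addE. Qed.

Lemma pure_tensorDl x x' y :
  pure_tensor (x + x') y = pure_tensor x y + pure_tensor x' y.
Proof. by rewrite -tensor_pi_cat; apply: tensor_piE; exact: tensor_eq_Dl. Qed.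

Lemma pure_tensorDr x y y' :
  pure_tensor x (y + y') = pure_tensor x y + pure_tensor x y'.
Proof. by rewrite -tensor_pi_cat; apply: tensor_piE; exact: tensor_eq_Dr. Qed.

Lemma pure_tensorZl (a : R) x y :
  pure_tensor (a *: x) y = a *: pure_tensor x y.
Proof. by rewrite [RHS]tensor_scaleE. Qed.

Lemma pure_tensorZr (a : R) x y :
  pure_tensor x (a *: y) = a *: pure_tensor x y.
Proof.
rewrite -pure_tensorZl; apply: tensor_piE; apply: tensor_eq_sym.
exact: tensor_eq_Z.
Qed.

Lemma tensor_sum_pure (u : tensor) : exists s : seq (M * N),
  u = \sum_(v <- s) pure_tensor v.1 v.2.
Proof.
have [s ->] := tensor_surj u; exists s.
elim: s => [|[x y] s IH]; first by rewrite big_nil.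
by rewrite big_cons -IH -tensor_pi_cat.
Qed.

Theorem tensor_universal (P : lmodType R) (beta : M -> N -> P) :
  (forall x, linear (beta x)) -> (forall y, linear (beta^~ y)) ->
  exists2 f : {linear tensor -> P},
    (forall x y, f (pure_tensor x y) = beta x y) &
    (forall g : {linear tensor -> P},
      (forall x y, g (pure_tensor x y) = beta x y) -> g =1 f).
Proof.
move=> linr linl; pose ev (s : seq (M * N)) := \sum_(v <- s) beta v.1 v.2.
have bDr x y y' : beta x (y + y') = beta x y + beta x y'.
  by rewrite -[y in LHS]scale1r linr scale1r.
have bDl x x' y : beta (x + x') y = beta x y + beta x' y.
  by rewrite -[x in LHS]scale1r linl scale1r.
have b0l y : beta 0 y = 0 by apply: (addrI (beta 0 y)); rewrite -bDl !addr0.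
have b0r x : beta x 0 = 0 by apply: (addrI (beta x 0)); rewrite -bDr !addr0.
have bZr a x y : beta x (a *: y) = a *: beta x y.
  by rewrite -[a *: y]addr0 linr b0r addr0.
have bZl a x y : beta (a *: x) y = a *: beta x y.
  by rewrite -[a *: x]addr0 linl b0l addr0.
have evE s t : tensor_eq s t -> ev s = ev t.
  rewrite /ev; elim=> {s t} [s|s t _ <-|t s u _ -> _ ->|s s' t t' _ e _ e'|
    s t|y|x x' y|x y y'|a x y] //.
  - by rewrite !big_cat e e'.
  - by rewrite !big_cat /= addrC.
  - by rewrite big_seq1 big_nil.
  - by rewrite !big_cons big_nil addr0 addr0 bDl.
  - by rewrite !big_cons big_nil addr0 addr0 bDr.
  - by rewrite !big_seq1 bZl bZr.
pose f (u : tensor) := ev (repr u).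
have fE s : f (\pi_tensor s) = ev s by apply: evE; exact: tensor_reprE.
have f_lin : linear f.
  move=> a u v; have [[s ->] [t ->]] := conj (tensor_surj u) (tensor_surj v).
  have -> : a *: \pi_tensor s = \pi_tensor (tensor_scale_seq a s).
    exact: tensor_scaleE.
  rewrite -tensor_pi_cat !fE /ev big_cat big_map scaler_sumr; congr (_ + _).
  by apply: eq_bigr => w _; rewrite bZl.
pose flin := GRing.isLinear.Build R tensor P _ f f_lin.
pose F : {linear tensor -> P} := HB.pack f flin.
exists F => [x y|g gE u]; first by rewrite /= fE /ev big_seq1.
have [s ->] := tensor_sum_pure u; rewrite !raddf_sum; apply: eq_bigr => v _.
transitivity (beta v.1 v.2); first exact: gE.
by rewrite /= fE /ev big_seq1.
Qed.

End TensorProduct.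

Definition lmod_iso (R : pzRingType) (M N : lmodType R) : Prop :=
  exists f : {linear M -> N}, bijective f.

Fixpoint tensor_pow (R : comPzRingType) (L : lmodType R) (n : nat) :
    lmodType R :=
  if n is n'.+1 then tensor L (tensor_pow L n') else R^o.

Definition invertible_module (R : comPzRingType) (L : lmodType R) : Prop :=
  exists L' : lmodType R, lmod_iso (tensor L L') R^o.

(* Pic(R) is the group of isomorphism classes of invertible R-modules, with   *)
(* the product induced by the tensor product and the class of R as unit.      *)
Definition pic_torsion (R : comPzRingType) : Prop :=
  forall L : lmodType R, invertible_module L ->
    exists2 n, (0 < n)%N & lmod_iso (tensor_pow L n) R^o.

Definition finite_algebra (A B : comPzRingType) (f : {rmorphism A -> B}) :
    Prop :=
  exists s : seq B, forall x : B, exists c : 'I_(size s) -> A,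
    x = \sum_i f (c i) * s`_i.

Definition pictorsion_ring (A : comPzRingType) : Prop :=
  forall (B : comPzRingType) (f : {rmorphism A -> B}),
    finite_algebra f -> pic_torsion B.

Definition ideal_closed (R : comPzRingType) (I : {pred R}) : Prop :=
  0 \in I /\ forall a, {in I &, forall u v, a * u + v \in I}.

Record gradedRing := GradedRing {
  graded_carrier :> comPzRingType;
  hcomp : nat -> {pred graded_carrier};
  hcompB : forall n, zmod_closed (hcomp n);
  hcomp1 : 1 \in hcomp 0;
  hcompM : forall m n x y,
    x \in hcomp m -> y \in hcomp n -> x * y \in hcomp (m + n)%N;
  hcomp_gen : forall x, exists n (c : nat -> graded_carrier),
    (forall i, c i \in hcomp i) /\ x = \sum_(i < n) c i;
  hcomp_direct : forall n (c : nat -> graded_carrier),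
    (forall i, c i \in hcomp i) -> \sum_(i < n) c i = 0 ->
    forall i, (i < n)%N -> c i = 0 }.
Arguments hcomp : clear implicits.
Arguments hcompB : clear implicits.

(* Points of Proj R: homogeneous primes not containing the irrelevant ideal. *)
Record projPoint (R : gradedRing) := ProjPoint {
  pt_ideal : R -> bool;
  pt_closed : ideal_closed pt_ideal;
  pt_proper : 1 \notin pt_ideal;
  pt_prime : forall u v, u * v \in pt_ideal ->
    (u \in pt_ideal) || (v \in pt_ideal);
  pt_homog : forall x, x \in pt_ideal -> exists n (c : nat -> R),
    (forall i, c i \in hcomp R i /\ c i \in pt_ideal) /\
    x = \sum_(i < n) c i;
  pt_relevant : exists n x,
    [/\ (0 < n)%N, x \in hcomp R n & x \notin pt_ideal] }.

(* R -> bool rather than {pred R} as the type of pt_ideal keeps projPoint R   *)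
(* in the universe of R.                                                      *)
Definition pt_mem (R : gradedRing) (p : projPoint R) : {pred R} := pt_ideal p.
Coercion pt_mem : projPoint >-> pred_sort.

Section HomogeneousLocalization.
Variables (R : gradedRing) (p : projPoint R).

Record hfrac := HFrac {
  hf_deg : nat;
  hf_num : R;
  hf_den : R;
  hf_numP : hf_num \in hcomp R hf_deg;
  hf_denP : hf_den \in hcomp R hf_deg;
  hf_denN : hf_den \notin p }.

HB.instance Definition _ := gen_eqMixin hfrac.
HB.instance Definition _ := gen_choiceMixin hfrac.

Definition hfrac_eq (u v : hfrac) : Prop :=
  exists n (t : R), [/\ t \in hcomp R n, t \notin p &
    t * (hf_num u * hf_den v) = t * (hf_num v * hf_den u)].

Definition hfrac_rel (u v : hfrac) : bool := `[< hfrac_eq u v >].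

Lemma ptN_mul (x y : R) : x \notin p -> y \notin p -> x * y \notin p.
Proof.
by move=> xp yp; apply/negP => /pt_prime; rewrite (negPf xp) (negPf yp).
Qed.

Lemma hfrac_rel_equiv : equiv_class_of hfrac_rel.
Proof.
split=> [u|u v|v u w].
- apply/asboolP; exists 0, 1; split=> //; [exact: hcomp1|exact: pt_proper].
- by apply/asboolP/asboolP => -[n [t [tn tp e]]]; exists n, t; split.
- move=> /asboolP[n [t [tn tp e]]] /asboolP[m [t' [tm tp' e']]].
  apply/asboolP; exists (n + (m + hf_deg v))%N, (t * (t' * hf_den v)); split.
  + by do 2?apply: hcompM => //; exact: hf_denP.
  + by do 2?apply: ptN_mul => //; exact: hf_denN.
  transitivity (t' * hf_den w * (t * (hf_num u * hf_den v))); first by ring.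
  rewrite e; transitivity (t * hf_den u * (t' * (hf_num v * hf_den w))).
    by ring.
  by rewrite e'; ring.
Qed.

Canonical hfrac_rel_equivRel := EquivRelPack hfrac_rel_equiv.
Canonical hfrac_rel_encModRel := defaultEncModRel hfrac_rel.

(* The degree 0 part of the localization of R at the homogeneous elements     *)
(* outside p.                                                                 *)
Definition hloc := {eq_quot hfrac_rel}.
HB.instance Definition _ : EqQuotient _ hfrac_rel hloc := EqQuotient.on hloc.
HB.instance Definition _ := Choice.on hloc.

Lemma hloc_piE (u v : hfrac) : hfrac_eq u v -> \pi_hloc u = \pi_hloc v.
Proof. by move=> uv; apply/(@eqquotP _ _ hloc)/asboolP. Qed.

Lemma hloc_reprE (u : hfrac) : hfrac_eq (repr (\pi_hloc u)) u.
Proof. by apply/asboolP/(@eqquotP _ _ hloc); rewrite reprK. Qed.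

Lemma hloc_surj (x : hloc) : exists u, x = \pi_hloc u.
Proof. by exists (repr x); rewrite reprK. Qed.

Lemma hcomp0 n : 0 \in hcomp R n. Proof. by have [] := hcompB R n. Qed.

Lemma hcompN n x : x \in hcomp R n -> - x \in hcomp R n.
Proof.
by have [h0 hB] := hcompB R n; move=> hx; rewrite -[- x]add0r; exact: hB.
Qed.

Lemma hcompD n x y : x \in hcomp R n -> y \in hcomp R n -> x + y \in hcomp R n.
Proof.
have [h0 hB] := hcompB R n; move=> hx hy; rewrite -[y]opprK.
by apply: hB => //; exact: hcompN.
Qed.

Lemma hadd_subproof (u v : hfrac) :
  hf_num u * hf_den v + hf_num v * hf_den u \in hcomp R (hf_deg u + hf_deg v).
Proof.
apply: hcompD; last rewrite addnC.
  by apply: hcompM; [exact: hf_numP|exact: hf_denP].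
by apply: hcompM; [exact: hf_numP|exact: hf_denP].
Qed.

Definition hfrac_add (u v : hfrac) : hfrac :=
  HFrac (hadd_subproof u v) (hcompM (hf_denP u) (hf_denP v))
    (ptN_mul (hf_denN u) (hf_denN v)).

Definition hfrac_mul (u v : hfrac) : hfrac :=
  HFrac (hcompM (hf_numP u) (hf_numP v)) (hcompM (hf_denP u) (hf_denP v))
    (ptN_mul (hf_denN u) (hf_denN v)).

Definition hfrac_opp (u : hfrac) : hfrac :=
  HFrac (hcompN (hf_numP u)) (hf_denP u) (hf_denN u).

Definition hfrac_zero : hfrac := HFrac (hcomp0 0) (hcomp1 R) (pt_proper p).
Definition hfrac_one : hfrac := HFrac (hcomp1 R) (hcomp1 R) (pt_proper p).

Lemma hfrac_add_eq u u' v v' : hfrac_eq u u' -> hfrac_eq v v' ->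
  hfrac_eq (hfrac_add u v) (hfrac_add u' v').
Proof.
move=> [n [t [tn tp e]]] [m [s [sm sp e']]].
exists (n + m)%N, (t * s); split; [exact: hcompM|exact: ptN_mul|] => /=.
transitivity (s * hf_den v * hf_den v' * (t * (hf_num u * hf_den u')) +
  t * hf_den u * hf_den u' * (s * (hf_num v * hf_den v'))); first by ring.
by rewrite e e'; ring.
Qed.

Lemma hfrac_mul_eq u u' v v' : hfrac_eq u u' -> hfrac_eq v v' ->
  hfrac_eq (hfrac_mul u v) (hfrac_mul u' v').
Proof.
move=> [n [t [tn tp e]]] [m [s [sm sp e']]].
exists (n + m)%N, (t * s); split; [exact: hcompM|exact: ptN_mul|] => /=.
transitivity ((t * (hf_num u * hf_den u')) * (s * (hf_num v * hf_den v'))).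
  by ring.
by rewrite e e'; ring.
Qed.

Lemma hfrac_opp_eq u u' : hfrac_eq u u' ->
  hfrac_eq (hfrac_opp u) (hfrac_opp u').
Proof.
by move=> [n [t [tn tp e]]]; exists n, t; split; rewrite //= !mulNr !mulrN e.
Qed.

Lemma hfrac_eqW u v : hf_num u * hf_den v = hf_num v * hf_den u ->
  hfrac_eq u v.
Proof.
move=> e; exists 0, 1; split; [exact: hcomp1|exact: pt_proper|by rewrite e].
Qed.

Definition hloc_zero : hloc := \pi_hloc hfrac_zero.
Definition hloc_one : hloc := \pi_hloc hfrac_one.
Definition hloc_add (x y : hloc) : hloc :=
  \pi_hloc (hfrac_add (repr x) (repr y)).
Definition hloc_mul (x y : hloc) : hloc :=
  \pi_hloc (hfrac_mul (repr x) (repr y)).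
Definition hloc_opp (x : hloc) : hloc := \pi_hloc (hfrac_opp (repr x)).

Lemma hloc_addE u v :
  hloc_add (\pi_hloc u) (\pi_hloc v) = \pi_hloc (hfrac_add u v).
Proof. by apply: hloc_piE; apply: hfrac_add_eq; exact: hloc_reprE. Qed.

Lemma hloc_mulE u v :
  hloc_mul (\pi_hloc u) (\pi_hloc v) = \pi_hloc (hfrac_mul u v).
Proof. by apply: hloc_piE; apply: hfrac_mul_eq; exact: hloc_reprE. Qed.

Lemma hloc_oppE u : hloc_opp (\pi_hloc u) = \pi_hloc (hfrac_opp u).
Proof. by apply: hloc_piE; apply: hfrac_opp_eq; exact: hloc_reprE. Qed.

Lemma hloc_addA : associative hloc_add.
Proof.
move=> x y z; have [[u ->] [v ->] [w ->]] :=
  And3 (hloc_surj x) (hloc_surj y) (hloc_surj z).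
by rewrite !hloc_addE; apply: hloc_piE; apply: hfrac_eqW => /=; ring.
Qed.

Lemma hloc_addC : commutative hloc_add.
Proof.
move=> x y; have [[u ->] [v ->]] := conj (hloc_surj x) (hloc_surj y).
by rewrite !hloc_addE; apply: hloc_piE; apply: hfrac_eqW => /=; ring.
Qed.

Lemma hloc_add0 : left_id hloc_zero hloc_add.
Proof.
move=> x; have [u ->] := hloc_surj x.
by rewrite hloc_addE; apply: hloc_piE; apply: hfrac_eqW => /=; ring.
Qed.

Lemma hloc_addN : left_inverse hloc_zero hloc_opp hloc_add.
Proof.
move=> x; have [u ->] := hloc_surj x.
by rewrite hloc_oppE hloc_addE; apply: hloc_piE; apply: hfrac_eqW => /=; ring.
Qed.

HB.instance Definition _ :=
  GRing.isZmodule.Build hloc hloc_addA hloc_addC hloc_add0 hloc_addN.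

Lemma hloc_mulA : associative hloc_mul.
Proof.
move=> x y z; have [[u ->] [v ->] [w ->]] :=
  And3 (hloc_surj x) (hloc_surj y) (hloc_surj z).
by rewrite !hloc_mulE; apply: hloc_piE; apply: hfrac_eqW => /=; ring.
Qed.

Lemma hloc_mulC : commutative hloc_mul.
Proof.
move=> x y; have [[u ->] [v ->]] := conj (hloc_surj x) (hloc_surj y).
by rewrite !hloc_mulE; apply: hloc_piE; apply: hfrac_eqW => /=; ring.
Qed.

Lemma hloc_mul1 : left_id hloc_one hloc_mul.
Proof.
move=> x; have [u ->] := hloc_surj x.
by rewrite hloc_mulE; apply: hloc_piE; apply: hfrac_eqW => /=; ring.
Qed.

Lemma hloc_mulDl : left_distributive hloc_mul hloc_add.
Proof.
move=> x y z; have [[u ->] [v ->] [w ->]] :=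
  And3 (hloc_surj x) (hloc_surj y) (hloc_surj z).
rewrite !(hloc_addE, hloc_mulE); apply: hloc_piE; apply: hfrac_eqW => /=.
by ring.
Qed.

HB.instance Definition _ := GRing.Zmodule_isComPzRing.Build hloc
  hloc_mulA hloc_mulC hloc_mul1 hloc_mulDl.

End HomogeneousLocalization.

Definition hloc_frac (R : gradedRing) (p : projPoint R) (n : nat) (r f : R)
    (rn : r \in hcomp R n) (fn : f \in hcomp R n) (fp : f \notin p) : hloc p :=
  \pi_(hloc p) (HFrac rn fn fp).

Section GlobalSections.
Variable R : gradedRing.

Definition stalk_family := forall p : projPoint R, hloc p.

HB.instance Definition _ := gen_eqMixin stalk_family.
HB.instance Definition _ := gen_choiceMixin stalk_family.

Let ext (s t : stalk_family) : (forall p, s p = t p) -> s = t.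
Proof. exact: functional_extensionality_dep. Qed.

Definition sf_zero : stalk_family := fun p => 0.
Definition sf_one : stalk_family := fun p => 1.
Definition sf_opp (s : stalk_family) : stalk_family := fun p => - s p.
Definition sf_add (s t : stalk_family) : stalk_family := fun p => s p + t p.
Definition sf_mul (s t : stalk_family) : stalk_family := fun p => s p * t p.

Lemma sf_addA : associative sf_add.
Proof. by move=> s t u; apply: ext => p; exact: addrA. Qed.
Lemma sf_addC : commutative sf_add.
Proof. by move=> s t; apply: ext => p; exact: addrC. Qed.
Lemma sf_add0 : left_id sf_zero sf_add.
Proof. by move=> s; apply: ext => p; exact: add0r. Qed.
Lemma sf_addN : left_inverse sf_zero sf_opp sf_add.
Proof. by move=> s; apply: ext => p; exact: addNr. Qed.
Lemma sf_mulA : associative sf_mul.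
Proof. by move=> s t u; apply: ext => p; exact: mulrA. Qed.
Lemma sf_mulC : commutative sf_mul.
Proof. by move=> s t; apply: ext => p; exact: mulrC. Qed.
Lemma sf_mul1 : left_id sf_one sf_mul.
Proof. by move=> s; apply: ext => p; exact: mul1r. Qed.
Lemma sf_mulDl : left_distributive sf_mul sf_add.
Proof. by move=> s t u; apply: ext => p; exact: mulrDl. Qed.

HB.instance Definition _ :=
  GRing.isZmodule.Build stalk_family sf_addA sf_addC sf_add0 sf_addN.
HB.instance Definition _ := GRing.Zmodule_isComPzRing.Build stalk_family
  sf_mulA sf_mulC sf_mul1 sf_mulDl.

(* The open sets are the complements of the sets V(E), E a set of homogeneous *)
(* elements.                                                                  *)
Definition proj_open (U : set (projPoint R)) : Prop :=
  exists E : set R, (forall h, E h -> exists n, h \in hcomp R n) /\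
    U = [set p : projPoint R | exists2 h, E h & h \notin p]%classic.

Definition locally_fraction (s : stalk_family) : Prop :=
  forall p, exists U, [/\ proj_open U, U p &
    exists n (r f : R) (rn : r \in hcomp R n) (fn : f \in hcomp R n),
      forall q, U q -> exists fq : f \notin q, s q = hloc_frac rn fn fq].

Definition regular_pred : {pred stalk_family} :=
  fun s => `[< locally_fraction s >].

Lemma regular_subring : subring_closed regular_pred.
Proof.
have openI U V : proj_open U -> proj_open V -> proj_open (U `&` V)%classic.
  move=> [E [hE ->]] [F [hF ->]].
  exists [set h | exists x y, [/\ E x, F y & h = x * y]]%classic; split.
    move=> h [x [y [Ex Fy ->]]]; have [n hx] := hE _ Ex; have [m hy] := hF _ Fy.
    by exists (n + m)%N; exact: hcompM.
  apply/seteqP; split => [p [[x Ex xp] [y Fy yp]]|p [h [x [y [Ex Fy ->]]] xyp]].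
    by exists (x * y); [exists x, y|exact: ptN_mul].
  have [_ pM] := pt_closed p; have [p0 _] := pt_closed p.
  split; [exists x => //|exists y => //]; apply: contra xyp => hp.
    by rewrite mulrC -[_ * _]addr0; exact: pM.
  by rewrite -[_ * _]addr0; exact: pM.
split.
- apply/asboolP => p; exists setT; split=> //.
    exists [set 1]%classic; split.
      by move=> h ->; exists 0%N; exact: hcomp1.
    by apply/seteqP; split => // q _; exists 1 => //; exact: pt_proper.
  exists 0%N, 1, 1, (hcomp1 R), (hcomp1 R) => q _; exists (pt_proper q).
  by [].
- move=> s t /asboolP sr /asboolP tr; apply/asboolP => p.
  have [U [oU Up [n [r [f [rn [fn eU]]]]]]] := sr p.
  have [V [oV Vp [m [r' [f' [rn' [fn' eV]]]]]]] := tr p.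
  exists (U `&` V)%classic; split => //; first exact: openI.
  have num : r * f' + - r' * f \in hcomp R (n + m).
    apply: hcompD; first exact: hcompM.
    by rewrite addnC; apply: hcompM => //; exact: hcompN.
  exists (n + m)%N, (r * f' + - r' * f), (f * f'), num, (hcompM fn fn').
  move=> q [Uq Vq]; have [fq sq] := eU q Uq; have [fq' tq] := eV q Vq.
  exists (ptN_mul fq fq').
  have -> : (s - t) q = hloc_add (s q) (hloc_opp (t q)) by [].
  rewrite sq tq /hloc_frac hloc_oppE hloc_addE.
  by apply: hloc_piE; apply: hfrac_eqW.
- move=> s t /asboolP sr /asboolP tr; apply/asboolP => p.
  have [U [oU Up [n [r [f [rn [fn eU]]]]]]] := sr p.
  have [V [oV Vp [m [r' [f' [rn' [fn' eV]]]]]]] := tr p.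
  exists (U `&` V)%classic; split => //; first exact: openI.
  exists (n + m)%N, (r * r'), (f * f'), (hcompM rn rn'), (hcompM fn fn').
  move=> q [Uq Vq]; have [fq sq] := eU q Uq; have [fq' tq] := eV q Vq.
  exists (ptN_mul fq fq').
  have -> : (s * t) q = hloc_mul (s q) (t q) by [].
  rewrite sq tq /hloc_frac hloc_mulE.
  by apply: hloc_piE; apply: hfrac_eqW.
Qed.

HB.instance Definition _ :=
  GRing.isSubringClosed.Build stalk_family regular_pred regular_subring.

(* The global sections of the structure sheaf of Proj R: families of germs    *)
(* that are locally quotients of homogeneous elements of the same degree.     *)
Record proj_sections := ProjSections {
  section_val :> stalk_family;
  section_valP : section_val \in regular_pred }.

HB.instance Definition _ := [isSub for section_val].
HB.instance Definition _ := [Choice of proj_sections by <:].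
HB.instance Definition _ := GRing.SubChoice_isSubComPzRing.Build
  stalk_family regular_pred proj_sections regular_subring.

End GlobalSections.

Section SchemeS.
Variables (A : comNzRingType) (a b : A).

Definition S_form : {mpoly A[2]} :=
  let X : {mpoly A[2]} := 'X_0 in let Y : {mpoly A[2]} := 'X_1 in
  X * (a *: Y - b *: X).

Definition S_ideal : {pred {mpoly A[2]}} :=
  fun f => `[< exists q, f = q * S_form >].

Lemma S_form_homog : S_form \is 2.-homog.
Proof.
have X1 (i : 'I_2) : ('X_i : {mpoly A[2]}) \is 1.-homog.
  by rewrite dhomogX; apply/eqP; exact: mdeg1.
have := @dhomogM 2 A mdeg 1%N _ 1%N _ (X1 0); apply.
by rewrite rpredB // dhomogZ.
Qed.

Lemma pihomog_S_form k (q : {mpoly A[2]}) :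
  exists2 q', pihomog mdeg k (q * S_form) = q' * S_form &
    ((k < 2)%N -> q' = 0).
Proof.
have := pihomog_partitionE (leqnn (mmeasure mdeg q)).
set m := mmeasure _ q => eq_q.
exists (\sum_(d < m | (d + 2 == k)%N) pihomog mdeg d q); last first.
  move=> k2; apply: big1 => d /eqP dk; move: k2.
  by rewrite -dk addnC ltnNge leq_addr.
rewrite {1}eq_q !mulr_suml raddf_sum [RHS]big_mkcond /=.
apply: eq_bigr => d _.
have h : pihomog mdeg d q * S_form \is (d + 2).-homog.
  by apply: dhomogM; [exact: pihomogP|exact: S_form_homog].
by case: eqP => [<-|/eqP dk]; [rewrite pihomog_dE|rewrite (pihomog_ne0 dk)].
Qed.

Lemma S_ideal_closed : idealr_closed S_ideal.
Proof.
split.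
- by apply/asboolP; exists 0; rewrite mul0r.
- apply/negP => /asboolP[q e]; have [q' eq' q'0] := pihomog_S_form 0 q.
  move: eq'; rewrite -e q'0 // mul0r pihomog_dE ?dhomog1 // => /eqP.
  by rewrite oner_eq0.
- move=> c u v /asboolP[q ->] /asboolP[r ->]; apply/asboolP.
  by exists (c * q + r); rewrite mulrDl mulrA.
Qed.

HB.instance Definition _ := isIdealr.Build {mpoly A[2]} S_ideal S_ideal_closed.

(* A[X,Y] / X(aY - bX)A[X,Y] *)
Definition S_ring := {ideal_quot S_ideal}.
HB.instance Definition _ := GRing.ComNzRing.on S_ring.

Definition S_comp (n : nat) : {pred S_ring} :=
  fun x => `[< exists2 f : {mpoly A[2]}, f \is n.-homog & x = \pi_S_ring f >].

Lemma S_compB n : zmod_closed (S_comp n).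
Proof.
split; first by apply/asboolP; exists 0; rewrite ?rpred0 // raddf0.
move=> x y /asboolP[f fn ->] /asboolP[g gn ->]; apply/asboolP.
by exists (f - g); rewrite ?rpredB // raddfB.
Qed.

Lemma S_comp1 : 1 \in S_comp 0.
Proof. by apply/asboolP; exists 1; rewrite ?dhomog1 // rmorph1. Qed.

Lemma S_compM m n x y :
  x \in S_comp m -> y \in S_comp n -> x * y \in S_comp (m + n).
Proof.
move=> /asboolP[f fm ->] /asboolP[g gn ->]; apply/asboolP.
by exists (f * g); [exact: dhomogM|rewrite rmorphM].
Qed.

Lemma S_comp_gen x : exists n (c : nat -> S_ring),
  (forall i, c i \in S_comp i) /\ x = \sum_(i < n) c i.
Proof.
have [f ->] : exists f, x = \pi_S_ring f by exists (repr x); rewrite reprK.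
exists (mmeasure mdeg f), (fun i => \pi_S_ring (pihomog mdeg i f)); split.
  by move=> i; apply/asboolP; exists (pihomog mdeg i f) => //; exact: pihomogP.
by rewrite -raddf_sum -pihomog_partitionE.
Qed.

Lemma S_ideal_piE (f : {mpoly A[2]}) :
  (\pi_S_ring f = 0) <-> (exists q, f = q * S_form).
Proof.
rewrite -[0](raddf0 \pi_S_ring); split.
  move=> /eqP; rewrite -[_ == _]Quotient.idealrBE subr0.
  by move=> /asboolP.
move=> fI; apply/eqP; rewrite -[_ == _]Quotient.idealrBE subr0.
exact/asboolP.
Qed.

Lemma S_comp_direct n (c : nat -> S_ring) :
  (forall i, c i \in S_comp i) -> \sum_(i < n) c i = 0 ->
  forall i, (i < n)%N -> c i = 0.
Proof.
move=> hc; have /choice[P hP] : forall i, exists f : {mpoly A[2]},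
    f \is i.-homog /\ c i = \pi_S_ring f.
  by move=> i; have /asboolP[f fi e] := hc i; exists f.
move=> c0 i lt_in; have [hi ->] := hP i; apply/S_ideal_piE.
have [q eq] : exists q, \sum_(j < n) P j = q * S_form.
  apply/S_ideal_piE; rewrite raddf_sum -[RHS]c0.
  by apply: eq_bigr => j _; have [_ ->] := hP j.
have [q' e _] := pihomog_S_form i q; exists q'; rewrite -e -eq raddf_sum /=.
rewrite (bigD1 (Ordinal lt_in)) //= pihomog_dE // big1 ?addr0 // => j ji.
apply: (pihomog_ne0 _ (hP j).1); apply: contraNneq ji => e'.
exact/eqP/val_inj.
Qed.

Definition S_graded : gradedRing :=
  @GradedRing S_ring S_comp S_compB S_comp1 S_compM S_comp_gen S_comp_direct.

(* The ring of global sections of Proj (A[X,Y] / X(aY - bX)A[X,Y]).           *)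
Definition S_sections : comPzRingType := proj_sections S_graded.

End SchemeS.

Definition primitive_point (A : comNzRingType) (a b : A) : Prop :=
  forall x : A, exists u v : A, x = a * u + b * v.

Definition good_point (A : comUnitRingType) (a b : A) : Prop :=
  primitive_point a b /\
  exists N (c : A), (0 < N)%N /\ b ^+ N + c * a \is a GRing.unit.

Definition good_ring (A : comUnitRingType) : Prop :=
  forall a b : A, primitive_point a b -> good_point a b.

Definition noetherian (A : comPzRingType) : Prop :=
  forall I : {pred A}, ideal_closed I -> exists s : seq A,
    {subset s <= I} /\
    forall x, x \in I -> exists c : 'I_(size s) -> A, x = \sum_i c i * s`_i.

Definition maximal_ideal (A : comNzRingType) (I : idealr A) : Prop :=
  forall J : idealr A, {subset I <= J} -> {subset J <= I}.

Definition integrally_closed (A : idomainType) : Prop :=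
  forall x : {fraction A}, integralOver (@tofrac A) x ->
    exists y : A, x = tofrac y.

Definition dedekind_domain (A : idomainType) : Prop :=
  [/\ noetherian A, integrally_closed A &
    forall P : prime_idealr A, (exists2 x, x \in P & x != 0) ->
      maximal_ideal P].

Definition finite_residue_fields (A : comNzRingType) : Prop :=
  forall M : idealr A, maximal_ideal M ->
    finite_set [set: {ideal_quot M}]%classic.

(* A divr_closed predicate meets the units in a subgroup of the unit group,   *)
(* and all the subgroups of the unit group arise so.                          *)
Definition units_finitely_generated (A : comUnitRingType) : Prop :=
  exists s : seq A, {subset s <= GRing.unit} /\
    forall H : {pred A}, divr_closed H -> {subset s <= H} ->
      {subset GRing.unit <= H}.

(* Main.v *)
(* For a nonzero in A, the class of b in A/aA is a unit of finite order, so   *)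
(* that b^N - 1 lies in aA for some N. The closed subscheme X = 0 of S(a,b)   *)
(* is a section of S(a,b) -> Spec A, so that A is a retract of the ring B of  *)
(* global sections; base change along A -> B -> A then embeds Pic(A) into     *)
(* Pic(B). The last claim holds because A is finite over itself.              *)
Require Import Defs.
From HB Require Import structures.
From mathcomp Require Import all_boot all_order all_algebra ring.
From mathcomp Require Import mpoly.
From mathcomp Require Import boolp classical_sets cardinality.

Set Implicit Arguments.
Unset Strict Implicit.
Unset Printing Implicit Defensive.

Import GRing.Theory.
Local Open Scope ring_scope.
Local Open Scope quotient_scope.

(** * Tensor products and base change *)

(** Goodness: let [(a, b)] be primitive. If [a = 0] then [b] is a unit. Otherwise [b] is a unit
    modulo the nonzero ideal [aA], and it suffices that units modulo a nonzero ideal have finite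
    order: then [b ^+ N - 1 = c * a], and [b ^+ N - c * a = 1]. This is noetherian induction
    ([unit_torsion_ideal]). An ideal maximal among the counterexamples would be prime, hence maximal
    with a finite residue field, where powers of a unit must repeat.

    Picard groups: if ring morphisms [A -> B -> A] compose to the identity, then a module over [A]
    is recovered from its base change to [B] by base change back to [A]. Base change respects tensor
    powers and the unit, so torsion of Pic(B) forces torsion of Pic(A) ([pic_torsion_retract]). For
    [B] the ring of global sections of S(a,b), the map [A -> B] sends [y] to the constant section
    [y]. The map [B -> A] restricts a section to the component X = 0, a copy of Spec A: the value at
    the generic point of that component is a fraction, and local expressions at the points over the
    maximal ideals show that it lies in [A] ([axis_value_sections]). *)

Lemma lmod_iso_intro (R : pzRingType) (M N : lmodType R) (h : M -> N)
    (k : N -> M) : linear h -> cancel h k -> cancel k h -> lmod_iso M N.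
Proof.
move=> h_lin hK kK; pose hL := GRing.isLinear.Build R M N _ h h_lin.
by exists (HB.pack h hL : {linear M -> N}); exists k.
Qed.

Lemma lmod_iso_elim (R : pzRingType) (M N : lmodType R) : lmod_iso M N ->
  exists (h : {linear M -> N}) (k : {linear N -> M}), cancel h k /\ cancel k h.
Proof.
move=> [h [k hK kK]].
have k_lin : linear k by move=> a u v; apply: (can_inj hK); rewrite linearP !kK.
pose kL := GRing.isLinear.Build R N M _ k k_lin.
by exists h, (HB.pack k kL : {linear N -> M}).
Qed.

Lemma lmod_iso_refl (R : pzRingType) (M : lmodType R) : lmod_iso M M.
Proof. by exists idfun; exists id. Qed.

Lemma lmod_iso_sym (R : pzRingType) (M N : lmodType R) :
  lmod_iso M N -> lmod_iso N M.
Proof. by move=> /lmod_iso_elim[h [k [hK kK]]]; exists k; exists h. Qed.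

Lemma lmod_iso_trans (R : pzRingType) (M N P : lmodType R) :
  lmod_iso M N -> lmod_iso N P -> lmod_iso M P.
Proof.
by move=> [h hb] [k kb]; exists (k \o h : {linear M -> P}); exact: bij_comp.
Qed.

Lemma tensor_ind (R : comPzRingType) (M N : lmodType R)
    (P : tensor M N -> Prop) :
  P 0 -> (forall u v, P u -> P v -> P (u + v)) ->
  (forall x y, P (pure_tensor x y)) -> forall u, P u.
Proof.
move=> P0 PD Pp u; have [s ->] := tensor_sum_pure u.
by elim/big_rec: _ => // v w _; exact: PD.
Qed.

Section TensorLift.
Variables (R : comPzRingType) (M N P : lmodType R) (beta : M -> N -> P).
Hypotheses (linr : forall x, linear (beta x)).
Hypotheses (linl : forall y, linear (beta^~ y)).

Definition tensor_lift : {linear tensor M N -> P} :=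
  s2val (cid2 (tensor_universal linr linl)).

Lemma tensor_liftE x y : tensor_lift (pure_tensor x y) = beta x y.
Proof. by rewrite /tensor_lift; case: cid2 => h /= ->. Qed.

End TensorLift.

Lemma tensor_iso (R : comPzRingType) (M M' N N' : lmodType R) :
  lmod_iso M M' -> lmod_iso N N' -> lmod_iso (tensor M N) (tensor M' N').
Proof.
move=> /lmod_iso_elim[h [h' [hK h'K]]] /lmod_iso_elim[k [k' [kK k'K]]].
have tl (M1 M2 N1 N2 : lmodType R) (u : {linear M1 -> M2})
    (v : {linear N1 -> N2}) : exists t : {linear tensor M1 N1 -> tensor M2 N2},
    forall x y, t (pure_tensor x y) = pure_tensor (u x) (v y).
  have lr x : linear (fun y => pure_tensor (u x) (v y)).
    by move=> a y y'; rewrite linearP pure_tensorDr pure_tensorZr.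
  have ll y : linear (fun x => pure_tensor (u x) (v y)).
    by move=> a x x'; rewrite linearP pure_tensorDl pure_tensorZl.
  by exists (tensor_lift lr ll) => x y; rewrite tensor_liftE.
have [t tE] := tl _ _ _ _ h k; have [t' t'E] := tl _ _ _ _ h' k'.
apply: (@lmod_iso_intro _ _ _ t t'); first exact: linearP.
- elim/tensor_ind => [|u v IHu IHv|x y]; first by rewrite !linear0.
    by rewrite !linearD IHu IHv.
  by rewrite tE t'E hK kK.
- elim/tensor_ind => [|u v IHu IHv|x y]; first by rewrite !linear0.
    by rewrite !linearD IHu IHv.
  by rewrite t'E tE h'K k'K.
Qed.

Lemma tensor_pow_iso (R : comPzRingType) (M N : lmodType R) n :
  lmod_iso M N -> lmod_iso (tensor_pow M n) (tensor_pow N n).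
Proof.
move=> MN; elim: n => [|n IHn] /=; first exact: lmod_iso_refl.
exact: tensor_iso.
Qed.

(** * Restriction and extension of scalars *)

Definition restr (A B : comPzRingType) (f : {rmorphism A -> B})
  (N : lmodType B) : Type := N.

Section Restriction.
Variables (A B : comPzRingType) (f : {rmorphism A -> B}) (N : lmodType B).
Local Notation restrN := (restr f N).

HB.instance Definition _ := GRing.Zmodule.on restrN.

Definition restr_scale (a : A) (x : restrN) : restrN := f a *: (x : N).

Lemma restr_scaleA a b x :
  restr_scale a (restr_scale b x) = restr_scale (a * b) x.
Proof. by rewrite /restr_scale scalerA rmorphM. Qed.

Lemma restr_scale1 : left_id 1 restr_scale.
Proof. by move=> x; rewrite /restr_scale rmorph1 scale1r. Qed.

Lemma restr_scaleDr : right_distributive restr_scale +%R.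
Proof. by move=> a x y; rewrite /restr_scale [LHS]scalerDr. Qed.

Lemma restr_scaleDl x : {morph restr_scale^~ x : a b / a + b}.
Proof. by move=> a b; rewrite /restr_scale rmorphD scalerDl. Qed.

HB.instance Definition _ := GRing.Zmodule_isLmodule.Build A restrN
  restr_scaleA restr_scale1 restr_scaleDr restr_scaleDl.

Lemma restrZ (a : A) (x : restrN) : a *: x = f a *: (x : N).
Proof. by []. Qed.

End Restriction.

(** These are the [A]-linear maps from [L] to [restr f N], stated without leaving [N]. *)
Definition semilinear_map (A B : comPzRingType) (f : {rmorphism A -> B})
    (L : lmodType A) (N : lmodType B) (h : L -> N) : Prop :=
  forall a x y, h (a *: x + y) = f a *: h x + h y.

(** Like [restr], a type synonym: the tensor product is already a module over [A], and the synonym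
    receives the [B]-module structure by multiplication on the left factor. *)
Definition base_change (A B : comPzRingType) (f : {rmorphism A -> B})
  (L : lmodType A) : Type := tensor (restr f B^o) L.

Section BaseChange.
Variables (A B : comPzRingType) (f : {rmorphism A -> B}) (L : lmodType A).
Local Notation bc := (base_change f L).
Local Notation T := (tensor (restr f B^o) L).
Local Notation pure := (@pure_tensor A (restr f B^o) L).

HB.instance Definition _ := GRing.Zmodule.on bc.

Let mul_pure (b : B) (x : restr f B^o) (l : L) : T := pure (b * x) l.

Let mul_linr b x : linear (mul_pure b x).
Proof. by move=> a l l'; rewrite /mul_pure pure_tensorDr pure_tensorZr. Qed.

Let mul_linl b l : linear (mul_pure b ^~ l).
Proof.
move=> a x x'; rewrite /mul_pure -pure_tensorZl -pure_tensorDl.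
by congr pure_tensor; rewrite mulrDr !restrZ /GRing.scale /= mulrCA.
Qed.

Definition bc_scale (b : B) (u : bc) : bc :=
  tensor_lift (mul_linr b) (mul_linl b) u.

Let bc_scaleE b x l : bc_scale b (pure x l) = pure (b * x) l.
Proof. by rewrite /bc_scale tensor_liftE. Qed.

Lemma bc_scaleDr : right_distributive bc_scale +%R.
Proof. by move=> b u v; rewrite /bc_scale [LHS]linearD. Qed.

Let bc_scale0 b : bc_scale b 0 = 0.
Proof. by rewrite /bc_scale [LHS]linear0. Qed.

Lemma bc_scaleA a b u : bc_scale a (bc_scale b u) = bc_scale (a * b) u.
Proof.
elim/tensor_ind: u => [|u v IHu IHv|x l]; first by rewrite !bc_scale0.
  by rewrite !bc_scaleDr IHu IHv.
by rewrite !bc_scaleE mulrA.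
Qed.

Lemma bc_scale1 : left_id 1 bc_scale.
Proof.
elim/tensor_ind => [|u v IHu IHv|x l]; first by rewrite !bc_scale0.
  by rewrite !bc_scaleDr IHu IHv.
by rewrite !bc_scaleE mul1r.
Qed.

Lemma bc_scaleDl u : {morph bc_scale^~ u : a b / a + b}.
Proof.
move=> a b; elim/tensor_ind: u => [|u v IHu IHv|x l].
- by rewrite !bc_scale0 addr0.
- by rewrite !bc_scaleDr IHu IHv addrACA.
- by rewrite !bc_scaleE mulrDl [LHS]pure_tensorDl.
Qed.

HB.instance Definition _ := GRing.Zmodule_isLmodule.Build B bc
  bc_scaleA bc_scale1 bc_scaleDr bc_scaleDl.

Definition bc_in (l : L) : bc := pure 1 l.

Lemma bc_in_semilinear : semilinear_map f bc_in.
Proof.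
move=> a l l'; rewrite /bc_in [LHS]pure_tensorDr pure_tensorZr -pure_tensorZl.
congr (_ + _); rewrite [RHS]bc_scaleE; congr pure_tensor.
Qed.

Lemma bc_in0 : bc_in 0 = 0.
Proof.
apply: (addrI (bc_in 0)); rewrite addr0 -{3}[0 : L]addr0.
by apply/esym; exact: pure_tensorDr.
Qed.

Lemma bc_inD l l' : bc_in (l + l') = bc_in l + bc_in l'.
Proof. exact: pure_tensorDr. Qed.

Lemma bc_inZ a l : bc_in (a *: l) = f a *: bc_in l.
Proof. by rewrite -[a *: l]addr0 bc_in_semilinear bc_in0 addr0. Qed.

Lemma bc_ind (P : bc -> Prop) :
  P 0 -> (forall u v, P u -> P v -> P (u + v)) ->
  (forall b l, P (b *: bc_in l)) -> forall u, P u.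
Proof.
move=> P0 PD Pp; elim/tensor_ind => // x l.
by have := Pp x l; rewrite [_ *: _]bc_scaleE mulr1.
Qed.

(** Extension of scalars is left adjoint to restriction. The map sending the pure tensor of [x] and
    [l] to [x *: h l] exists over [A] by the universal property of the tensor product; its
    [B]-linearity is then checked on pure tensors. *)
Lemma bc_universal (N : lmodType B) (h : L -> N) : semilinear_map f h ->
  exists H : {linear bc -> N}, forall l, H (bc_in l) = h l.
Proof.
move=> h_slin.
pose beta (x : restr f B^o) (l : L) : restr f N := (x : B) *: h l.
have linr x : linear (beta x).
  move=> a l l'; rewrite /beta h_slin scalerDr; congr (_ + _).
  by rewrite restrZ !scalerA mulrC.
have linl l : linear (beta^~ l).
  move=> a x x'; rewrite /beta [LHS]scalerDl; congr (_ + _).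
  by rewrite !restrZ -[LHS]scalerA.
pose H (u : bc) : N := tensor_lift linr linl u.
have HE x l : H (pure_tensor x l) = (x : B) *: h l by rewrite /H tensor_liftE.
have HD u v : H (u + v) = H u + H v by rewrite /H [LHS]linearD.
have H0 : H 0 = 0 by rewrite /H [LHS]linear0.
have H_lin : linear H.
  move=> b u v; rewrite HD; congr (_ + _).
  elim/tensor_ind: u => [|u w IHu IHw|x l]; first by rewrite scaler0 H0 scaler0.
    by rewrite scalerDr HD IHu IHw HD scalerDr.
  by rewrite [b *: _]bc_scaleE !HE scalerA.
pose HL := GRing.isLinear.Build B bc N _ H H_lin.
exists (HB.pack H HL : {linear bc -> N}) => l.
by rewrite /= HE scale1r.
Qed.

End BaseChange.

(** * Base change as a monoidal functor *)

Section Monoidal.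
Variables (A B : comPzRingType) (f : {rmorphism A -> B}).

Lemma bc_ext (L : lmodType A) (N : lmodType B)
    (h k : {linear base_change f L -> N}) :
  (forall l, h (bc_in f l) = k (bc_in f l)) -> h =1 k.
Proof.
move=> hk; elim/bc_ind => [|u v IHu IHv|b l]; first by rewrite !linear0.
  by rewrite !linearD IHu IHv.
by rewrite !linearZZ hk.
Qed.

Lemma bc_iso (L L' : lmodType A) :
  lmod_iso L L' -> lmod_iso (base_change f L) (base_change f L').
Proof.
move=> /lmod_iso_elim[h [k [hK kK]]].
have sl (M M' : lmodType A) (u : {linear M -> M'}) :
    semilinear_map f (fun x => bc_in f (u x)).
  by move=> a x y; rewrite linearP bc_in_semilinear.
have [H HE] := bc_universal (sl _ _ h); have [K KE] := bc_universal (sl _ _ k).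
apply: (@lmod_iso_intro _ _ _ H K); first exact: linearP.
- by apply: (@bc_ext _ _ (K \o H) idfun) => l /=; rewrite HE KE hK.
- by apply: (@bc_ext _ _ (H \o K) idfun) => l /=; rewrite KE HE kK.
Qed.

Lemma bc_unit : lmod_iso (base_change f A^o) B^o.
Proof.
have f_sl : @semilinear_map A B f A^o B^o f.
  by move=> a x y; rewrite rmorphD rmorphM.
have [H HE] := bc_universal f_sl.
pose k (b : B^o) : base_change f A^o := (b : B) *: bc_in f (1 : A^o).
apply: (@lmod_iso_intro _ _ _ H k).
- exact: linearP.
- rewrite /k; elim/bc_ind => [|u v IHu IHv|b l].
    by rewrite linear0 scale0r.
    by rewrite linearD scalerDl IHu IHv.
  rewrite linearZZ HE /= -scalerA; congr (_ *: _).
  by rewrite -bc_inZ; congr bc_in; exact: mulr1.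
- by move=> b; rewrite linearZZ HE rmorph1 /= [LHS]mulr1.
Qed.

(** Universal properties give maps [G] and [F] in both directions, matching
    [bc_in f (pure_tensor l l')] with the pure tensor of [bc_in f l] and [bc_in f l']. They are
    mutually inverse because these elements generate. *)
Lemma bc_tensor (L L' : lmodType A) :
  lmod_iso (base_change f (tensor L L'))
    (tensor (base_change f L) (base_change f L')).
Proof.
pose T := tensor L L'; pose S := tensor (base_change f L) (base_change f L').
(* [F] is built one variable at a time: [h] extends the pairing to [base_change f L'] for fixed [l],
   then [H] extends it in [l]. *)
have /choice[h hE] : forall l, exists h : {linear base_change f L' ->
    base_change f T}, forall l', h (bc_in f l') = bc_in f (pure_tensor l l').
  move=> l; apply: bc_universal => a x y.
  by rewrite pure_tensorDr pure_tensorZr bc_in_semilinear.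
have h_sl u : semilinear_map f (h^~ u).
  move=> a x y; elim/bc_ind: u => [|u v IHu IHv|b l].
  - by rewrite !linear0 addr0.
  - by rewrite !linearD IHu IHv addrACA.
  - rewrite ![h _ (_ *: _)]linearZZ !hE pure_tensorDl pure_tensorZl.
    by rewrite bc_in_semilinear scalerDr !scalerA mulrC.
have /choice[H HE] u := bc_universal (h_sl u).
have H_linl u' : linear (fun u => H u' u) by exact: linearP.
have H_linr u : linear (H^~ u).
  move=> b x y; elim/bc_ind: u => [|u v IHu IHv|c l].
  - by rewrite !linear0 addr0.
  - by rewrite !linearD IHu IHv addrACA.
  - by rewrite ![H _ (_ *: _)]linearZZ !HE linearP scalerDr !scalerA mulrC.
pose F := @tensor_lift _ _ _ _ (fun u u' => H u' u) H_linr H_linl.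
have linr l : linear (fun l' => bc_in f l' : restr f (base_change f L')).
  by move=> a x y; rewrite bc_in_semilinear.
pose beta l l' : restr f S := pure_tensor (bc_in f l) (bc_in f l').
have beta_linr l : linear (beta l).
  move=> a x y; rewrite /beta bc_in_semilinear [LHS]pure_tensorDr.
  by rewrite pure_tensorZr.
have beta_linl l' : linear (beta^~ l').
  move=> a x y; rewrite /beta bc_in_semilinear [LHS]pure_tensorDl.
  by rewrite pure_tensorZl.
pose g := tensor_lift beta_linr beta_linl.
have g_sl : semilinear_map f (fun t => g t : S).
  by move=> a x y; rewrite linearP.
have [G GE] := bc_universal g_sl.
apply: (@lmod_iso_intro _ _ _ G F); first exact: linearP.
- apply: (@bc_ext _ _ (F \o G) idfun) => t /=; rewrite GE.
  elim/tensor_ind: t => [|t u IHt IHu|l l'].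
  + by rewrite linear0 [LHS]linear0 bc_in0.
  + by rewrite linearD [LHS]linearD IHt IHu bc_inD.
  + by rewrite tensor_liftE [LHS]tensor_liftE HE hE.
- elim/tensor_ind => [|t u IHt IHu|u u']; first by rewrite !linear0.
    by rewrite !linearD IHt IHu.
  rewrite tensor_liftE; elim/bc_ind: u => [|u v IHu IHv|b l].
  + rewrite !linear0; apply/esym.
    by have := pure_tensorZl 0 (0 : base_change f L) u'; rewrite !scale0r.
  + by rewrite !linearD IHu IHv pure_tensorDl.
  + rewrite [H _ _]linearZZ [G _]linearZZ HE pure_tensorZl /=; congr (_ *: _).
    elim/bc_ind: u' => [|u v IHu IHv|c l'].
    * rewrite !linear0; apply/esym.
      have := pure_tensorZr 0 (bc_in f l) (0 : base_change f L').
      by rewrite !scale0r.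
    * by rewrite !linearD IHu IHv pure_tensorDr.
    * rewrite [h _ _]linearZZ [G _]linearZZ hE GE pure_tensorZr.
      by rewrite [g _]tensor_liftE.
Qed.

Lemma bc_tensor_pow (L : lmodType A) n :
  lmod_iso (base_change f (tensor_pow L n)) (tensor_pow (base_change f L) n).
Proof.
elim: n => [|n IHn] /=; first exact: bc_unit.
apply: lmod_iso_trans (bc_tensor _ _) _.
by apply: tensor_iso => //; exact: lmod_iso_refl.
Qed.

Lemma bc_invertible (L : lmodType A) :
  invertible_module L -> invertible_module (base_change f L).
Proof.
move=> [L' LL']; exists (base_change f L').
apply: lmod_iso_trans (lmod_iso_sym (bc_tensor _ _)) _.
exact: lmod_iso_trans (bc_iso LL') bc_unit.
Qed.

End Monoidal.

Lemma bc_retract (A B : comPzRingType) (f : {rmorphism A -> B})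
    (g : {rmorphism B -> A}) (L : lmodType A) :
  cancel f g -> lmod_iso (base_change g (base_change f L)) L.
Proof.
move=> fK.
(* View [L] as a [B]-module through [g]; its restriction along [f] is [L] again, since
   [g (f a) = a]. Two uses of the adjunction then yield the map to [L]. *)
have id_sl : semilinear_map f (fun l : L => l : restr g L).
  by move=> a x y; rewrite restrZ fK.
have [h hE] := bc_universal id_sl.
have h_sl : semilinear_map g (fun u => h u : L).
  by move=> b x y; rewrite linearP restrZ.
have [H HE] := bc_universal h_sl.
apply: (@lmod_iso_intro _ _ _ H (fun l => bc_in g (bc_in f l))).
- exact: linearP.
- have kh u : bc_in g (bc_in f (h u)) = bc_in g u.
    elim/bc_ind: u => [|u v IHu IHv|b l]; first by rewrite linear0 !bc_in0.
      by rewrite linearD !bc_inD IHu IHv.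
    by rewrite linearZZ hE restrZ !bc_inZ fK.
  elim/bc_ind => [|u v IHu IHv|b u]; first by rewrite linear0 !bc_in0.
    by rewrite linearD !bc_inD IHu IHv.
  by rewrite linearZZ HE !bc_inZ fK kh.
- by move=> l; rewrite HE hE.
Qed.

Lemma pic_torsion_retract (A B : comPzRingType) (f : {rmorphism A -> B})
    (g : {rmorphism B -> A}) : cancel f g -> pic_torsion B -> pic_torsion A.
Proof.
move=> fK tB L /(bc_invertible f)/tB[n n_gt0 LnB]; exists n => //.
apply: lmod_iso_trans (bc_unit g); apply: lmod_iso_trans (bc_iso g LnB).
apply: lmod_iso_trans (lmod_iso_sym (bc_tensor_pow _ _ _)).
by apply: tensor_pow_iso; apply: lmod_iso_sym; exact: bc_retract.
Qed.

(** * Ideals and good rings *)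

Section IdealClosed.
Variables (A : comPzRingType) (I : {pred A}) (hI : ideal_closed I).

Lemma ideal_mull a x : x \in I -> a * x \in I.
Proof. by have [I0 IM] := hI; move=> Ix; rewrite -[_ * _]addr0 IM. Qed.

Lemma ideal_mulr a x : x \in I -> x * a \in I.
Proof. by rewrite mulrC; exact: ideal_mull. Qed.

Lemma ideal_add x y : x \in I -> y \in I -> x + y \in I.
Proof. by have [I0 IM] := hI; move=> Ix Iy; rewrite -[x]mul1r IM. Qed.

Lemma ideal_sum (J : finType) (c : J -> A) :
  (forall j, c j \in I) -> \sum_j c j \in I.
Proof.
by have [I0 _] := hI; move=> cI; elim/big_ind: _ => //; exact: ideal_add.
Qed.

Definition ideal_adjoin (x : A) : {pred A} :=
  [pred z | `[< exists a, exists2 u, u \in I & z = a * x + u >]].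

Lemma ideal_adjoinP x z :
  reflect (exists a, exists2 u, u \in I & z = a * x + u)
    (z \in ideal_adjoin x).
Proof. exact: asboolP. Qed.

Lemma ideal_adjoin_closed x : ideal_closed (ideal_adjoin x).
Proof.
have [I0 _] := hI; split.
  by apply/ideal_adjoinP; exists 0, 0; rewrite // mul0r addr0.
move=> a _ _ /ideal_adjoinP[b [u Iu ->]] /ideal_adjoinP[c [v Iv ->]].
apply/ideal_adjoinP; exists (a * b + c), (a * u + v); last by ring.
by apply: ideal_add => //; exact: ideal_mull.
Qed.

Lemma sub_ideal_adjoin x : {subset I <= ideal_adjoin x}.
Proof.
by move=> u Iu; apply/ideal_adjoinP; exists 0, u; rewrite // mul0r add0r.
Qed.

Lemma mem_ideal_adjoin x : x \in ideal_adjoin x.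
Proof.
have [I0 _] := hI.
by apply/ideal_adjoinP; exists 1, 0; rewrite // mul1r addr0.
Qed.

End IdealClosed.

(** Otherwise choice yields a strictly increasing sequence [u] of ideals. Their union is an ideal,
    and its finitely many generators already lie in some [u n], so the sequence stops growing
    there. *)
Lemma noetherian_max (A : comPzRingType) (P : {pred A} -> Prop) :
  noetherian A -> (exists2 I, ideal_closed I & P I) ->
  exists I, [/\ ideal_closed I, P I & forall J, ideal_closed J ->
    {subset I <= J} -> P J -> {subset J <= I}].
Proof.
move=> noethA [I0 hI0 PI0]; apply: contrapT => no_max.
pose T := {I : {pred A} | ideal_closed I /\ P I}.
have /choice[g gP] (I : T) : exists J : T, {subset sval I <= sval J} /\
    ~ {subset sval J <= sval I}.
  case: I => I [hI PI] /=; apply: contrapT => no_J; apply: no_max.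
  exists I; split=> // J hJ IJ PJ; apply: contrapT => nJI; apply: no_J.
  by exists (exist _ J (conj hJ PJ)).
pose u n := iter n g (exist _ I0 (conj hI0 PI0) : T).
have u_mono m n : (m <= n)%N -> {subset sval (u m) <= sval (u n)}.
  elim: n => [|n IHn]; first by rewrite leqn0 => /eqP->.
  rewrite leq_eqVlt ltnS => /predU1P[->//|/IHn umn] x /umn.
  exact: (gP (u n)).1.
have uI n : ideal_closed (sval (u n)) := (svalP (u n)).1.
pose U : {pred A} := [pred x | `[< exists n, x \in sval (u n) >]].
have UP x : reflect (exists n, x \in sval (u n)) (x \in U) := asboolP _.
have hU : ideal_closed U.
  split; first by apply/UP; exists 0%N; case: (uI 0%N).
  move=> a x y /UP[m xm] /UP[n yn]; apply/UP; exists (maxn m n).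
  apply: ideal_add => //; last by apply: u_mono yn; exact: leq_maxr.
  by apply: ideal_mull => //; apply: u_mono xm; exact: leq_maxl.
have [s [sU Us]] := noethA U hU.
have [n sn] : exists n, {subset s <= sval (u n)}.
  elim: s sU {Us} => [|x s IHs] sU; first by exists 0%N.
  have [n sn] := IHs (fun y ys => sU y (mem_behead (s := x :: s) ys)).
  have /UP[m xm] := sU x (mem_head _ _).
  exists (maxn m n) => y /[!inE] /predU1P[->|/sn yn].
    by apply: u_mono xm; exact: leq_maxl.
  by apply: u_mono yn; exact: leq_maxr.
apply: (gP (u n)).2 => x xg.
have /Us[c ->] : x \in U by apply/UP; exists n.+1.
by apply: ideal_sum => // i; apply: ideal_mull => //; apply: sn; exact: mem_nth.
Qed.

Lemma idealr_pack (A : comNzRingType) (I : {pred A}) :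
  ideal_closed I -> 1 \notin I -> exists J : idealr A, J =i I.
Proof.
move=> [I0 IM] I1.
pose m := isIdealr.Build A I (And3 I0 I1 IM).
by exists (HB.pack I m : idealr A).
Qed.

Lemma maximal_ideal_exists (A : comNzRingType) (I : {pred A}) :
  noetherian A -> ideal_closed I -> 1 \notin I ->
  exists2 M : idealr A, maximal_ideal M & {subset I <= M}.
Proof.
move=> noethA hI I1.
have [|M [hM [IM M1] maxM]] := @noetherian_max A
    (fun J => {subset I <= J} /\ 1 \notin J) noethA.
  by exists I => //; split.
have [N NM] := idealr_pack hM M1; exists N; last by move=> x /IM; rewrite NM.
move=> J NJ x; rewrite NM; apply: maxM.
- split; first exact: rpred0.
  by move=> a u v uJ vJ; rewrite rpredD // idealMr.
- by move=> y; rewrite -NM; exact: NJ.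
- by split=> [y /IM|]; rewrite ?idealr1 // -NM; exact: NJ.
Qed.

(** If the ideal generated by [M] and [x] contains 1, multiply [1 = a * x + u] by [y]; if not,
    maximality puts [x] in [M]. *)
Lemma maximal_idealM (A : comNzRingType) (M : idealr A) x y :
  maximal_ideal M -> x * y \in M -> x \in M \/ y \in M.
Proof.
move=> maxM Mxy.
have hM : ideal_closed M.
  by split=> [|a u v uM vM]; [exact: rpred0|rewrite rpredD // idealMr].
have [/ideal_adjoinP[a [u Mu e]]|M1] := boolP (1 \in ideal_adjoin M x).
  right; rewrite -[y]mul1r e mulrDl -mulrA; apply: rpredD.
    exact: idealMr.
  by rewrite mulrC; exact: idealMr.
have [J JM] := idealr_pack (ideal_adjoin_closed hM x) M1.
left; apply: (maxM J) => [z Mz|]; rewrite JM; first exact: sub_ideal_adjoin.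
exact: mem_ideal_adjoin.
Qed.

Lemma finite_pigeonhole (T : Type) (h : nat -> T) :
  finite_set [set: T]%classic ->
  exists i j, (i < j)%N /\ h i = h j.
Proof.
move=> finT; apply: contrapT => no_ij; apply: infinite_nat.
rewrite -(preimage_setT h); apply: finite_preimage => // i j _ _ hij.
by case: (ltngtP i j) => // ij; case: no_ij; [exists i, j|exists j, i].
Qed.

(** * Finite order of units modulo nonzero ideals *)

Section GoodRing.
Variable A : idomainType.
Hypothesis A_dedekind : dedekind_domain A.
Hypothesis A_residue : finite_residue_fields A.

(* Carrying the first clause along makes the induction go through a product   *)
(* of ideals: if u^2 and k are in I then (1 + u)^k = 1 modulo I.              *)
Let unit_torsion (I : {pred A}) : Prop :=
  (exists2 k, (0 < k)%N & k%:R \in I) /\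
  forall b c, c * b - 1 \in I -> exists2 n, (0 < n)%N & b ^+ n - 1 \in I.

(** As [x * y] is in [I], so is the product of the two enlarged ideals ([adjM]). Hence [k * m] is in
    [I], and so is the square of [u = b ^+ (n * p) - 1], because [u] lies in both of them. *)
Let unit_torsion_adjoin (I : {pred A}) x y : ideal_closed I -> x * y \in I ->
  unit_torsion (ideal_adjoin I x) -> unit_torsion (ideal_adjoin I y) ->
  unit_torsion I.
Proof.
move=> hI Ixy [[k k0 kI] tx] [[m m0 mI] ty].
have adjM u v : u \in ideal_adjoin I x -> v \in ideal_adjoin I y -> u * v \in I.
  move=> /ideal_adjoinP[a [i Ii ->]] /ideal_adjoinP[a' [i' Ii' ->]].
  have -> : (a * x + i) * (a' * y + i') =
      a * a' * (x * y) + (a * x * i' + (a' * y + i') * i) by ring.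
  by do 2?[apply: ideal_add => //]; apply: ideal_mull.
have kmI : (k * m)%:R \in I by rewrite natrM adjM.
split; first by exists (k * m)%N; rewrite // muln_gt0 k0.
move=> b c cbI.
have [n n0 nI] := tx b c (sub_ideal_adjoin x cbI).
have [p p0 pI] := ty b c (sub_ideal_adjoin y cbI).
pose u := b ^+ (n * p) - 1.
have ux : u \in ideal_adjoin I x.
  rewrite /u exprM subrX1; apply: ideal_mulr => //; exact: ideal_adjoin_closed.
have uy : u \in ideal_adjoin I y.
  rewrite /u mulnC exprM subrX1; apply: ideal_mulr => //.
  exact: ideal_adjoin_closed.
exists (n * p * (k * m))%N; first by rewrite !muln_gt0 n0 p0 k0.
rewrite exprM -[b ^+ (n * p)](subrK 1) -/u.
(* The binomial expansion modulo [u * u]; for [j = k * m] the linear term also lies in [I]. *)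
have powI j : (u + 1) ^+ j - 1 - j%:R * u \in I.
  elim: j => [|j IHj]; first by rewrite expr0 mul0r subr0 subrr; case: hI.
  rewrite exprS (_ : _ - _ = ((u + 1) ^+ j - 1 - j%:R * u) * (u + 1) +
    j%:R * (u * u)); last by rewrite -natr1; ring.
  by apply: ideal_add => //; [exact: ideal_mulr|apply/ideal_mull/adjM].
rewrite -[X in X \in I](subrK ((k * m)%:R * u)).
by apply: ideal_add => //; exact: ideal_mulr.
Qed.

(** A nonzero prime is maximal, so its quotient is finite. The pigeonhole principle applies to the
    multiples of 1 and to the powers of [b]; a power of [b] can be cancelled since none lies in
    [I]. *)
Let unit_torsion_prime (I : {pred A}) : ideal_closed I -> 1 \notin I ->
  (exists2 x, x \in I & x != 0) ->
  (forall x y, x * y \in I -> x \in I \/ y \in I) -> unit_torsion I.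
Proof.
move=> hI I1 I_neq0 I_prime; have [I0 IM] := hI.
pose m := isIdealr.Build A I (And3 I0 I1 IM).
have prI x y : x * y \in I -> (x \in I) || (y \in I).
  by move=> /I_prime[] ->; rewrite ?orbT.
pose m' := isPrimeIdealrClosed.Build A I prI.
pose P : prime_idealr A := HB.pack I m m'.
have [_ _ /(_ P I_neq0) maxP] := A_dedekind.
have finP := A_residue maxP.
have piE x y : \pi_({ideal_quot P}) x = \pi y -> y - x \in I.
  by move=> /esym/eqP; rewrite -Quotient.idealrBE.
split.
  have [i [j [lij /piE e]]] :=
    finite_pigeonhole (fun n => \pi_({ideal_quot P}) n%:R) finP.
  by exists (j - i)%N; [rewrite subn_gt0|rewrite natrB // ltnW].
move=> b c cbI.
have [i [j [lij /piE e]]] :=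
  finite_pigeonhole (fun n => \pi_({ideal_quot P}) (b ^+ n)) finP.
exists (j - i)%N; first by rewrite subn_gt0.
have bNI n : b ^+ n \notin I.
  elim: n => [|n IHn]; first by rewrite expr0.
  rewrite exprS; apply/negP => /I_prime[] bI; last by rewrite bI in IHn.
  apply: (negP I1); rewrite -[1](subKr (c * b)) -mulN1r.
  by apply: ideal_add => //; exact: ideal_mull.
have : b ^+ i * (b ^+ (j - i) - 1) \in I.
  by rewrite mulrBr mulr1 -exprD subnKC // ltnW.
by move=> /I_prime[] // bI; move: (bNI i); rewrite bI.
Qed.

(** A maximal counterexample [M] is prime: were [x * y] in [M] with neither factor in it, both
    ideals obtained by adjoining a factor would have the property, and [unit_torsion_adjoin] would
    give it to [M]. *)
Lemma unit_torsion_ideal (I : {pred A}) : ideal_closed I ->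
  (exists2 x, x \in I & x != 0) -> unit_torsion I.
Proof.
move=> hI I_neq0; apply: contrapT => ntI.
have [noethA _ _] := A_dedekind.
have [|M [hM [M_neq0 ntM] maxM]] := @noetherian_max A (fun J =>
    (exists2 x, x \in J & x != 0) /\ ~ unit_torsion J) noethA.
  by exists I => //; split.
have adjT x : x \notin M -> unit_torsion (ideal_adjoin M x).
  move=> xM; apply: contrapT => ntMx; move/negP: xM; apply.
  apply: (maxM (ideal_adjoin M x)); last exact: mem_ideal_adjoin.
  - exact: ideal_adjoin_closed.
  - exact: sub_ideal_adjoin.
  - split=> //; have [z zM z0] := M_neq0; exists z => //.
    exact: sub_ideal_adjoin.
have [M1|M1] := boolP (1 \in M).
  apply: (ntM); split=> [|b _ _]; exists 1%N => //.
  by rewrite -[_ - _]mulr1; exact: ideal_mull.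
apply: (ntM); apply: unit_torsion_prime => // x y Mxy.
have [xM|xM] := boolP (x \in M); first by left.
have [yM|yM] := boolP (y \in M); first by right.
case: ntM; exact: unit_torsion_adjoin Mxy (adjT x xM) (adjT y yM).
Qed.

Lemma dedekind_good_ring : good_ring A.
Proof.
move=> a b ab; split=> //; have [u [v uv]] := ab 1.
have [a0|a0] := eqVneq a 0.
  exists 1%N, 0; split=> //; rewrite mul0r addr0 expr1; apply/unitrPr.
  by exists v; rewrite uv a0 mul0r add0r.
pose I : {pred A} := [pred x | `[< exists c, x = c * a >]].
have IP x : reflect (exists c, x = c * a) (x \in I) := asboolP _.
have hI : ideal_closed I.
  split; first by apply/IP; exists 0; rewrite mul0r.
  move=> c _ _ /IP[d ->] /IP[e ->]; apply/IP; exists (c * d + e).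
  by rewrite mulrDl mulrA.
(* From [1 = a * u + b * v], the inverse of [b] modulo [a] is [v]. *)
have [|_ /(_ b v)[|n n0 /IP[c e]]] := unit_torsion_ideal hI.
- by exists a => //; apply/IP; exists 1; rewrite mul1r.
- by apply/IP; exists (- u); rewrite uv; ring.
by exists n, (- c); rewrite mulNr -e subKr unitr1.
Qed.

End GoodRing.

(** * Global sections of S(a,b) *)

Section Sections.
Variables (A : idomainType) (a b : A).
Local Notation S := (S_graded a b).
Local Notation piS := \pi_(S_ring a b).

(* The projection of A[X,Y] onto the homogeneous coordinate ring A[Y] of the  *)
(* component X = 0.                                                           *)
Definition axis_eval : {rmorphism {mpoly A[2]} -> {poly A}} :=
  mmap (@polyC A) (fun i : 'I_2 => if i == 0 then 0 else 'X).

Local Notation phi0 := axis_eval.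

Let phi0_form : phi0 (S_form a b) = 0.
Proof.
rewrite /S_form rmorphM /= (_ : phi0 'X_0 = 0) ?mul0r //.
by rewrite /axis_eval /= mmapX mmap1U eqxx.
Qed.

Let phi0_homog n (f : {mpoly A[2]}) : f \is n.-homog ->
  exists c, phi0 f = c *: 'X^n.
Proof.
move=> /dhomogP fn; rewrite /axis_eval /= /mmap big_seq.
elim/big_ind: _ => [|_ _ [c ->] [d ->]|m /fn mn].
- by exists 0; rewrite scale0r.
- by exists (c + d); rewrite scalerDl.
rewrite /mmap1 big_ord_recl big_ord1 /= mul_polyC.
have : mdeg m = n by []; rewrite mdegE big_ord_recl big_ord1.
have -> : lift ord0 ord0 = 1 :> 'I_2 by apply/val_inj.
case: (m ord0) => [|k] e; last first.
  by exists 0; rewrite expr0n /= mul0r scaler0 scale0r.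
by exists f@_m; rewrite -e mul1r.
Qed.

(** The factorization of [phi0] through the quotient; it is independent of the representative
    ([axis_coordE]) because [S_form] is divisible by X. *)
Definition axis_coord (x : S) : {poly A} := phi0 (repr x).
Local Notation phi := axis_coord.

Lemma axis_coordE f : phi (piS f) = phi0 f.
Proof.
have [q e] : exists q, repr (piS f) - f = q * S_form a b.
  by apply/S_ideal_piE; rewrite rmorphB /= reprK subrr.
by apply/eqP; rewrite -subr_eq0 -rmorphB e rmorphM phi0_form mulr0.
Qed.

Lemma S_surj (x : S) : exists f, x = piS f.
Proof. by exists (repr x); rewrite reprK. Qed.

Lemma axis_coordB : zmod_morphism phi.
Proof.
move=> x y; have [[f ->] [g ->]] := conj (S_surj x) (S_surj y).
by rewrite -[_ - _](rmorphB piS) !axis_coordE rmorphB.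
Qed.

Lemma axis_coordM : monoid_morphism phi.
Proof.
split=> [|x y]; first by rewrite -[1](rmorph1 piS) axis_coordE rmorph1.
have [[f ->] [g ->]] := conj (S_surj x) (S_surj y).
by rewrite -[_ * _](rmorphM piS) !axis_coordE rmorphM.
Qed.

HB.instance Definition _ :=
  GRing.isZmodMorphism.Build S {poly A} phi axis_coordB.
HB.instance Definition _ :=
  GRing.isMonoidMorphism.Build S {poly A} phi axis_coordM.

Lemma axis_coord_homog n x : x \in hcomp S n -> exists c, phi x = c *: 'X^n.
Proof. by move=> /asboolP[f fn ->]; rewrite axis_coordE; exact: phi0_homog. Qed.

(** * Points of the component X = 0 *)

Section AxisPoint.
Variable P : {pred A}.
Hypotheses (hP : ideal_closed P) (PN1 : 1 \notin P).
Hypothesis P_prime : forall x y, x * y \in P -> x \in P \/ y \in P.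

(** The preimage of [P[Y]] under [phi]: the homogeneous prime of the point of X = 0 lying over
    [P]. *)
Definition axis_ideal (x : S) : bool := `[< forall i, (phi x)`_i \in P >].

Lemma axis_idealP x : reflect (forall i, (phi x)`_i \in P) (x \in axis_ideal).
Proof. exact: asboolP. Qed.

Let P0 : 0 \in P. Proof. by case: hP. Qed.

Lemma axis_ideal_closed : ideal_closed axis_ideal.
Proof.
split; first by apply/axis_idealP => i; rewrite rmorph0 coef0.
move=> x u v /axis_idealP up /axis_idealP vp; apply/axis_idealP => i.
rewrite rmorphD rmorphM coefD coefM; apply: ideal_add => //.
by apply: ideal_sum => // j; exact: ideal_mull.
Qed.

Lemma axis_ideal_proper : 1 \notin axis_ideal.
Proof.
apply/negP => /axis_idealP/(_ 0%N); rewrite rmorph1 coef1 /=.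
by apply/negP.
Qed.

Let axis_idealN x : x \notin axis_ideal -> exists2 i, (phi x)`_i \notin P &
  forall j, (j < i)%N -> (phi x)`_j \in P.
Proof.
move=> xN; have exi : exists i, (phi x)`_i \notin P.
  apply: contrapT => no_i; move/negP: xN; apply; apply/axis_idealP => i.
  by apply: contrapT => /negP iN; apply: no_i; exists i.
case: (ex_minnP exi) => i iN i_min; exists i => // j ji.
by apply: contrapT => /negP/i_min; rewrite leqNgt ji.
Qed.

(** Gauss's lemma: if [i] and [j] are the least indices of coefficients outside [P], the coefficient
    of index [i + j] of the product is congruent modulo [P] to the product of these two. *)
Lemma axis_ideal_prime u v :
  u * v \in axis_ideal -> (u \in axis_ideal) || (v \in axis_ideal).
Proof.
move=> /axis_idealP uvP; apply: contrapT => /negP; rewrite negb_or.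
move=> /andP[/axis_idealN[i iN i_min] /axis_idealN[j jN j_min]].
have := uvP (i + j)%N; rewrite rmorphM coefM.
have lt_i : (i < (i + j).+1)%N by rewrite ltnS leq_addr.
rewrite (bigD1 (Ordinal lt_i)) //= addKn.
set s := \sum_(k | _) _ => e.
suff sP : s \in P.
  have /P_prime[] : (phi u)`_i * (phi v)`_j \in P; last 2 first.
  - by move=> iP; rewrite iP in iN.
  - by move=> jP; rewrite jP in jN.
  rewrite -[X in X \in P](addrK s) -[- s]mulN1r.
  by apply: ideal_add => //; exact: ideal_mull.
rewrite /s big_mkcond; apply: ideal_sum => // k.
case: eqVneq => //= ki; have [lt_ki|lt_ik|ki'] := ltngtP k i.
- by apply: ideal_mulr => //; exact: i_min.
- apply: ideal_mull => //; apply: j_min.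
  by rewrite ltn_subLR ?ltn_add2r // -ltnS.
- by case/eqP: ki; exact/val_inj.
Qed.

Lemma axis_ideal_homog x : x \in axis_ideal -> exists n (c : nat -> S),
  (forall i, c i \in hcomp S i /\ c i \in axis_ideal) /\ x = \sum_(i < n) c i.
Proof.
move=> /axis_idealP xP; have [n [c [hc e]]] := hcomp_gen x.
(* Components of index at least [n] do not enter the sum and need not lie in the ideal, so they are
   replaced by 0. *)
exists n, (fun i => if (i < n)%N then c i else 0); split; last first.
  by rewrite e; apply: eq_bigr => i _; rewrite ltn_ord.
move=> i; case: ifP => [lt_in|_]; last first.
  by split; [exact: hcomp0|case: axis_ideal_closed].
split; first exact: hc.
apply/axis_idealP => j; have [d ed] := axis_coord_homog (hc i).
rewrite ed coefZ coefXn; case: eqP => [_|_]; last by rewrite mulr0.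
rewrite mulr1; have := xP i; rewrite e rmorph_sum coef_sum.
rewrite (bigD1 (Ordinal lt_in)) //= ed coefZ coefXn eqxx mulr1 big1 ?addr0 //.
move=> k ki; have [d' ->] := axis_coord_homog (hc k).
rewrite coefZ coefXn; case: eqP => [ik|_]; last by rewrite mulr0.
by case/eqP: ki; apply/val_inj.
Qed.

Lemma axis_ideal_relevant : exists n x,
  [/\ (0 < n)%N, x \in hcomp S n & x \notin axis_ideal].
Proof.
exists 1%N, (piS 'X_1); split=> //.
  by apply/asboolP; exists 'X_1 => //; rewrite dhomogX; apply/eqP/mdeg1.
apply/negP => /axis_idealP/(_ 1%N).
by rewrite axis_coordE /axis_eval /= mmapX mmap1U /= coefX eqxx; apply/negP.
Qed.

Definition axis_point : projPoint S :=
  ProjPoint axis_ideal_closed axis_ideal_proper axis_ideal_prime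
    axis_ideal_homog axis_ideal_relevant.

End AxisPoint.

(** * Values of sections at the generic point of X = 0 *)

Lemma hloc_eqP (R : gradedRing) (p : projPoint R) (u v : hfrac p) :
  \pi_(hloc p) u = \pi v <-> hfrac_eq u v.
Proof.
split; last exact: hloc_piE.
by move=> /(@eqquotP _ _ (hloc p)) /asboolP.
Qed.

Let zero_ideal : {pred A} := pred1 0.

Let zero_closed : ideal_closed zero_ideal.
Proof.
split; first exact: eqxx.
by move=> x u v /eqP-> /eqP->; rewrite mulr0 addr0 inE.
Qed.

Let zero_proper : 1 \notin zero_ideal.
Proof. by rewrite inE oner_eq0. Qed.

Let zero_prime x y :
  x * y \in zero_ideal -> x \in zero_ideal \/ y \in zero_ideal.
Proof. by rewrite !inE mulf_eq0 => /orP. Qed.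

Definition axis_generic : projPoint S :=
  axis_point zero_closed zero_proper zero_prime.
Local Notation p0 := axis_generic.

Lemma axis_genericN x : x \notin p0 -> phi x != 0.
Proof.
apply: contraNneq => x0; apply/axis_idealP => i.
by rewrite x0 coef0 inE.
Qed.

(* The residue field at p0 is the fraction field of A, so that axis_value x y *)
(* says that x has the value y there.                                         *)
Definition axis_value (x : hloc p0) (y : A) : Prop :=
  phi (hf_num (repr x)) = y%:P * phi (hf_den (repr x)).

(** Any fraction representing the germ may be used: [phi] is nonzero outside [p0], and [{poly A}] is
    a domain, so denominators cancel. *)
Lemma axis_valueP (u : hfrac p0) y :
  axis_value (\pi u) y <-> phi (hf_num u) = y%:P * phi (hf_den u).
Proof.
have /hloc_eqP[n [t [_ /axis_genericN t0 /(congr1 phi)]]] :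
  \pi_(hloc p0) (repr (\pi_(hloc p0) u)) = \pi u by rewrite reprK.
rewrite /axis_value !rmorphM /= => /(mulfI t0) e.
have d0 := axis_genericN (hf_denN u).
have d0' := axis_genericN (hf_denN (repr (\pi_(hloc p0) u))).
split=> [e'|e']; first by apply: (mulIf d0'); rewrite -e e'; ring.
by apply: (mulIf d0); rewrite e e'; ring.
Qed.

Lemma axis_value_inj x y z : axis_value x y -> axis_value x z -> y = z.
Proof.
rewrite /axis_value => -> /mulIf e; apply/polyC_inj/e.
exact/axis_genericN/hf_denN.
Qed.

Lemma axis_valueB x x' y y' : axis_value x y -> axis_value x' y' ->
  axis_value (x - x') (y - y').
Proof.
have [[u ->] [v ->]] := conj (hloc_surj x) (hloc_surj x').
move=> /axis_valueP eu /axis_valueP ev.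
have -> : \pi_(hloc p0) u - \pi_(hloc p0) v =
    \pi_(hloc p0) (hfrac_add u (hfrac_opp v)).
  by rewrite -hloc_addE -hloc_oppE.
apply/axis_valueP; rewrite /= rmorphD !rmorphM rmorphN /= eu ev polyCB.
by ring.
Qed.

Lemma axis_valueM x x' y y' : axis_value x y -> axis_value x' y' ->
  axis_value (x * x') (y * y').
Proof.
have [[u ->] [v ->]] := conj (hloc_surj x) (hloc_surj x').
move=> /axis_valueP eu /axis_valueP ev.
have -> : \pi_(hloc p0) u * \pi_(hloc p0) v = \pi_(hloc p0) (hfrac_mul u v).
  by rewrite -hloc_mulE.
by apply/axis_valueP; rewrite /= !rmorphM /= eu ev; ring.
Qed.

Lemma axis_value1 : axis_value 1 1.
Proof. by apply/axis_valueP; rewrite /= rmorph1 mulr1. Qed.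

(** [D] is the ideal of denominators of the value of [s] at [p0]. If it were proper, it would lie in
    a maximal ideal [M]. Near the point [q] over [M], [s] is [r / f] with [phi r = y *: 'X^n] and
    [phi f = d *: 'X^n], where [d] is not in [M]; but then [d] is in [D]. *)
Lemma axis_value_sections (s : S_sections a b) : noetherian A ->
  exists y, axis_value (section_val s p0) y.
Proof.
move=> noethA; have [u eu] := hloc_surj (section_val s p0); rewrite eu.
pose D : {pred A} := [pred d | `[< exists y, d%:P * phi (hf_num u) =
  y%:P * phi (hf_den u) >]].
have DP d : reflect (exists y, d%:P * phi (hf_num u) = y%:P * phi (hf_den u))
  (d \in D) := asboolP _.
have hD : ideal_closed D.
  split; first by apply/DP; exists 0; rewrite polyC0 !mul0r.
  move=> c d d' /DP[y e] /DP[y' e']; apply/DP; exists (c * y + y').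
  by rewrite !rmorphD !rmorphM /= !mulrDl -!mulrA e e'.
have [/DP[y e]|DN1] := boolP (1 \in D).
  by exists y; apply/axis_valueP; rewrite -e mul1r.
have [M maxM DM] := maximal_ideal_exists noethA hD DN1.
have hM : ideal_closed M.
  by split=> [|c x y xM yM]; [exact: rpred0|rewrite rpredD // idealMr].
have MN1 : 1 \notin M by rewrite idealr1.
pose q := axis_point hM MN1 (fun x y => @maximal_idealM _ M x y maxM).
have [U [[E [hE ->]] [h Eh hq] [n [r [f [rn [fn sU]]]]]]] :=
  asboolP _ (section_valP s) q.
(* The point [p0] specializes to [q], so the neighbourhood of [q] where [s] is [r / f] contains
   [p0]. *)
have sub x : x \notin q -> x \notin p0.
  apply: contra => /axis_idealP xp; apply/axis_idealP => i.
  by have /eqP-> := xp i; exact: rpred0.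
have [|fp0 ep0] := sU p0; first by exists h => //; exact: sub.
have [|fq _] := sU q; first by exists h.
have [y ey] := axis_coord_homog rn; have [d ed] := axis_coord_homog fn.
have dM : d \notin M.
  apply: contra fq => dM; apply/axis_idealP => i; rewrite ed coefZ mulrC.
  exact: idealMr.
case/negP: dM; apply: DM; apply/DP; exists y.
have /hloc_eqP[m [t [_ /axis_genericN t0 /(congr1 phi)]]] :
    \pi_(hloc p0) u = \pi_(hloc p0) (HFrac rn fn fp0) by rewrite -eu.
rewrite !rmorphM /= => /(mulfI t0); rewrite ey ed -!mul_polyC => e.
have X0 : 'X^n != 0 :> {poly A} by rewrite monic_neq0 // monicXn.
apply: (mulIf X0); transitivity (phi (hf_num u) * (d%:P * 'X^n)); first by ring.
by rewrite e; ring.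
Qed.

(** * Constant sections and the retraction *)

Definition S_const (y : A) : S := piS y%:MP.

Lemma S_const0 y : S_const y \in hcomp S 0.
Proof.
apply/asboolP; exists y%:MP => //.
by rewrite -[y%:MP]mulr1 mul_mpolyC rpredZ ?dhomog1.
Qed.

Lemma axis_coord_const y : phi (S_const y) = y%:P.
Proof. by rewrite axis_coordE /= mmapC. Qed.

Definition const_germ (y : A) : stalk_family S :=
  fun p => \pi_(hloc p) (HFrac (S_const0 y) (hcomp1 S) (pt_proper p)).

Lemma const_germ_regular y : const_germ y \in @regular_pred S.
Proof.
apply/asboolP => p; exists setT; split=> //.
  exists [set 1]%classic; split.
    by move=> h ->; exists 0%N; exact: hcomp1.
  by apply/seteqP; split => // q _; exists 1 => //; exact: pt_proper.
exists 0%N, (S_const y), 1, (S_const0 y), (hcomp1 S) => q _.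
by exists (pt_proper q).
Qed.

Definition const_section (y : A) : S_sections a b :=
  ProjSections (const_germ_regular y).

Lemma const_sectionB : zmod_morphism const_section.
Proof.
move=> y z; apply/val_inj/functional_extensionality_dep => p /=.
transitivity (hloc_add (const_germ y p) (hloc_opp (const_germ z p))) => //.
rewrite /const_germ hloc_oppE hloc_addE; apply: hloc_piE.
by apply: hfrac_eqW; rewrite /= /S_const !rmorphB /=; ring.
Qed.

Lemma const_sectionM : monoid_morphism const_section.
Proof.
split=> [|y z]; apply/val_inj/functional_extensionality_dep => p /=.
  apply: (@hloc_piE _ p _ (hfrac_one p)); apply: hfrac_eqW => /=.
  by rewrite /S_const !rmorph1.
transitivity (hloc_mul (const_germ y p) (const_germ z p)) => //.
rewrite /const_germ hloc_mulE; apply: hloc_piE; apply: hfrac_eqW => /=.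
by rewrite /S_const !rmorphM /=; ring.
Qed.

Lemma axis_value_const y : axis_value (section_val (const_section y) p0) y.
Proof. by apply/axis_valueP; rewrite /= rmorph1 mulr1 axis_coord_const. Qed.

(** The retraction [g] takes the value at [p0]. It is a ring morphism because values are unique and
    compatible with the operations, and a constant section has its constant as value. *)
Lemma S_sections_retract : noetherian A ->
  exists (f : {rmorphism A -> S_sections a b})
    (g : {rmorphism S_sections a b -> A}), cancel f g.
Proof.
move=> noethA.
have /choice[g gP] :
    forall s : S_sections a b, exists y, axis_value (section_val s p0) y.
  by move=> s; exact: axis_value_sections.
have gB : zmod_morphism g.
  move=> s t; apply: axis_value_inj (gP _) _.
  by apply: axis_valueB; exact: gP.
have gM : monoid_morphism g.
  split=> [|s t]; apply: axis_value_inj (gP _) _; first exact: axis_value1.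
  by apply: axis_valueM; exact: gP.
pose f1 := GRing.isZmodMorphism.Build _ _ const_section const_sectionB.
pose f2 := GRing.isMonoidMorphism.Build _ _ const_section const_sectionM.
pose g1 := GRing.isZmodMorphism.Build _ _ g gB.
pose g2 := GRing.isMonoidMorphism.Build _ _ g gM.
exists (HB.pack const_section f1 f2 : {rmorphism _ -> _}).
exists (HB.pack g g1 g2 : {rmorphism _ -> _}) => y /=.
exact: axis_value_inj (gP _) (axis_value_const y).
Qed.

End Sections.

Theorem proposition4p13 (A : idomainType) (iota : {rmorphism A -> {poly rat}})
    (iota_inj : injective iota)
    (ZT_sub : forall p : {poly int}, exists x : A, iota x = map_poly intr p)
    (A_dedekind : dedekind_domain A)
    (A_residue : finite_residue_fields A)
    (A_units : units_finitely_generated A)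
    (A_pic : ~ pic_torsion A) :
  good_ring A /\
  (forall a b : A, primitive_point a b -> ~ pic_torsion (S_sections a b)) /\
  ~ pictorsion_ring A.
Proof.
have [noethA _ _] := A_dedekind; split; first exact: dedekind_good_ring.
split=> [a b _ picS|picA].
  have [f [g fK]] := S_sections_retract a b noethA.
  exact: A_pic (pic_torsion_retract fK picS).
apply: A_pic; apply: (picA A idfun); exists [:: 1] => x.
by exists (fun=> x); rewrite big_ord1 mulr1.
Qed.
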